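(* Let $d>1$ be an integer. There is a constant $C=C(d)>0$ such that if $q$ is a prime power with $q\equiv1\pmod d$ and $q\geq C$, then the finite field $\mathbb{F}_q$ admits a complete mapping $f$ with $f(0)=0$ such that both $f$ and $f+\operatorname{id}$ permute $\mathbb{F}_q^{\ast}$ cyclically and $f$ is not an additive function $\mathbb{F}_q\to\mathbb{F}_q$.
   Context: A complete mapping of $\mathbb{F}_q$ is a function $f:\mathbb{F}_q\to\mathbb{F}_q$ such that both $f$ and $f+\operatorname{id}:x\mapsto f(x)+x$ are permutations of $\mathbb{F}_q$. A permutation fixing $0$ permutes $\mathbb{F}_q^{\ast}$ cyclically if its restriction to $\mathbb{F}_q^{\ast}$ is a single cycle of length $q-1$. A function $f$ is additive if $f(x+y)=f(x)+f(y)$ for all $x,y\in\mathbb{F}_q$. *)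

(* Defs.v *)
From mathcomp Require Import all_boot all_algebra.

Set Implicit Arguments.
Unset Strict Implicit.
Unset Printing Implicit Defensive.

Import GRing.Theory.
Local Open Scope ring_scope.

Definition prime_power (q : nat) : Prop :=
  exists p k : nat, [/\ prime p, (0 < k)%N & q = (p ^ k)%N].

Definition add_id (F : finFieldType) (f : F -> F) : F -> F :=
  fun x => f x + x.

Definition complete_mapping (F : finFieldType) (f : F -> F) : Prop :=
  bijective f /\ bijective (add_id f).

(* The list [c] is cycle notation for the restriction of [f] to F^*:
   [ufcycle f c] says that its entries are pairwise distinct and that [f] sends
   each entry to the next one, and the last entry to the first. *)
Definition permutes_nonzero_cyclically (F : finFieldType) (f : F -> F) : Prop :=
  [/\ bijective f, f 0 = 0 &
      exists c : seq F,
        [/\ ufcycle f c, c =i [pred x | x != 0] & size c = #|F|.-1]].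

Definition additive_function (F : finFieldType) (f : F -> F) : Prop :=
  {morph f : x y / x + y}.

(* Main.v *)
(** With n = q - 1 = d m, w a generator of F_q^* and z = w^m, take
    f x = k(x^m) x with coefficients k(1) = a, k(z) = b and c otherwise.  If
    a, b, c all have m-th power z then f moves each coset of the subgroup of
    index d to the next one, so f is cyclic on F_q^* iff a b c^(d-2) generates
    that subgroup; for f + id replace a, b, c by a+1, b+1, c+1.  If a <> b
    and f is additive then (x, y) |-> x + y is injective on a product of two
    cosets, so m^2 <= q, which fails for large q.
    Character sums are avoided in finding a and b: since (a, b) |->
    (a/b, (a+1)/(b+1)) is injective off the diagonal, the pairs (a, a+1) are
    equidistributed, in mean square, among the pairs of cosets of two
    subgroups of F_q^*.  The number of (a, b) with both products lying in given
    subgroups is a correlation of these coset counts, and inclusion-exclusion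
    over the primes dividing m selects the products which are generators. *)

Require Import Defs.
From mathcomp Require Import all_boot all_order all_algebra cyclic finfield.
From mathcomp Require Import ring lra zify.

Set Implicit Arguments.
Unset Strict Implicit.
Unset Printing Implicit Defensive.

Import Order.TTheory GRing.Theory Num.Theory.
Local Open Scope ring_scope.

(** * Correlation of a function with its translate under a permutation *)

(** Since [s] permutes [P], the left side is the sum of (x_i - rho)(x_(s i) - rho), and |uv| <= (u^2
    + v^2)/2 bounds it by the variance. Here [rho] is arbitrary; later it is the expected size of a
    cell. *)
Lemma sum_mul_perm_close (R : realFieldType) (I : finType) (P : {set I})
    (s : I -> I) (x : I -> R) (rho : R) :
    {in P &, injective s} -> {in P, forall i, s i \in P} ->
  `|\sum_(i in P) x i * x (s i)
      - (2 * rho * (\sum_(i in P) x i) - rho ^+ 2 * #|P|%:R)|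
    <= \sum_(i in P) (x i - rho) ^+ 2.
Proof.
move=> s_inj sP.
have imP : s @: P = P.
  apply/eqP; rewrite eqEcard card_in_imset // leqnn andbT.
  by apply/subsetP => _ /imsetP [i Pi ->]; apply: sP.
have reindexP (g : I -> R) : \sum_(i in P) g (s i) = \sum_(i in P) g i.
  by rewrite -[in RHS]imP big_imset.
have -> : \sum_(i in P) x i * x (s i)
    - (2 * rho * (\sum_(i in P) x i) - rho ^+ 2 * #|P|%:R)
    = \sum_(i in P) (x i - rho) * (x (s i) - rho).
  have -> : rho ^+ 2 * #|P|%:R = \sum_(i in P) rho ^+ 2.
    by rewrite sumr_const mulr_natr.
  rewrite -mulrA mulr2n mulrDl mul1r -{2}(reindexP x) !mulr_sumr.
  rewrite -!big_split /= -sumrB -sumrB; apply: eq_bigr => i _.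
  ring.
apply: (le_trans (ler_norm_sum _ _ _)).
have -> : \sum_(i in P) (x i - rho) ^+ 2
    = \sum_(i in P) (((x i - rho) ^+ 2 + (x (s i) - rho) ^+ 2) / 2).
  rewrite -mulr_suml big_split /= (reindexP (fun i => (x i - rho) ^+ 2)).
  by field.
apply: ler_sum => i _; set a := x i - rho; set b := x (s i) - rho.
have := sqr_ge0 (a - b); have := sqr_ge0 (a + b).
by rewrite ler_norml => h1 h2; apply/andP; split; lra.
Qed.

(** * Second moment of the coset counts of the pairs (a, a + 1) *)

Definition roots_unity (F : finFieldType) (h : nat) : {set F} :=
  [set x | x ^+ h == 1].

Lemma card_roots_unity_le (F : finFieldType) (h : nat) :
  (0 < h)%N -> (#|roots_unity F h| <= h)%N.
Proof.
move=> h_gt0; rewrite cardE; apply: max_unity_roots => //;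
  last exact: enum_uniq.
by apply/allP => x; rewrite mem_enum inE unity_rootE.
Qed.

Lemma card_roots_unity (F : finFieldType) (k : nat) (z : F) :
  k.-primitive_root z -> #|roots_unity F k| = k.
Proof.
move=> prim_z; apply/eqP.
rewrite eqn_leq card_roots_unity_le ?(prim_order_gt0 prim_z) //=.
rewrite -[X in (X <= _)%N]card_ord.
have inj : injective (fun i : 'I_k => z ^+ i).
  move=> i j /eqP; rewrite (eq_prim_root_expr prim_z) !modn_small //.
  by move/eqP => /val_inj.
rewrite -(card_imset _ inj); apply/subset_leq_card/subsetP => _ /imsetP [i _ ->].
by rewrite inE exprAC (prim_expr_order prim_z) expr1n.
Qed.

(** When [h1] and [h2] divide q - 1, a nonempty level prescribes the coset of a modulo the subgroup
    of order [h1] and that of a + 1 modulo the subgroup of order [h2]. *)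
Definition level (F : finFieldType) (h1 h2 : nat) (p : F * F) : {set F} :=
  [set a | [&& a != 0, a + 1 != 0, a ^+ h1 == p.1 & (a + 1) ^+ h2 == p.2]].

Lemma card_neq0_neqN1 (F : finFieldType) :
  #|[set a : F | (a != 0) && (a + 1 != 0)]| = #|F|.-2.
Proof.
have -> : [set a : F | (a != 0) && (a + 1 != 0)] = ~: [set 0; -1].
  by apply/setP => a; rewrite !inE negb_or addr_eq0.
by rewrite cardsCs setCK cards2 eq_sym oppr_eq0 oner_neq0 subn2.
Qed.

Lemma sum_sq_fibers (T U : finType) (D : {set T}) (f : T -> U) :
  (\sum_(u : U) #|[set a in D | f a == u]| ^ 2
    = #|[set ab : T * T | [&& ab.1 \in D, ab.2 \in D & f ab.1 == f ab.2]]|)%N.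
Proof.
rewrite -[RHS]sum1_card (partition_big (fun ab => f ab.1) predT) //=.
apply: eq_bigr => u _; rewrite sum1_card -mulnn -cardsX.
apply: eq_card => -[a b]; rewrite inE /= !inE [in RHS]unfold_in /= inE /=.
case: (a \in D) => //=; case: (b \in D); rewrite ?andbF //= andbC [RHS]andbC.
by case: (f a =P u) => [->|_]; rewrite ?andbF // !andbT eq_sym.
Qed.

(** The sum counts pairs (a, b) in a common level. The diagonal gives q - 2; off it, both ratios are
    nontrivial roots of unity and determine the pair, which leaves at most (h1 - 1)(h2 - 1). *)
Lemma sum_sq_level (F : finFieldType) (h1 h2 : nat) :
  (0 < h1)%N -> (0 < h2)%N ->
  (\sum_p #|@level F h1 h2 p| ^ 2 <= #|F|.-2 + h1.-1 * h2.-1)%N.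
Proof.
move=> h1_gt0 h2_gt0.
pose D := [set a : F | (a != 0) && (a + 1 != 0)].
pose f (a : F) := (a ^+ h1, (a + 1) ^+ h2).
have -> : (\sum_p #|@level F h1 h2 p| ^ 2
    = \sum_p #|[set a in D | f a == p]| ^ 2)%N.
  apply: eq_bigr => p _; congr (_ ^ 2)%N; apply: eq_card => a.
  by rewrite !inE -!andbA.
rewrite sum_sq_fibers; set E := [set _ | _].
pose diag := [set ab : F * F | ab.1 == ab.2].
rewrite -(cardsID diag E); apply: leq_add.
  rewrite -card_neq0_neqN1 -/D -(card_imset D (f := fun a => (a, a))); last first.
    by move=> a b [].
  apply/subset_leq_card/subsetP => -[a b].
  rewrite inE => /andP [abE]; rewrite inE /= => /eqP eab.
  move: abE; rewrite inE /= => /and3P [aD _ _].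
  by apply/imsetP; exists a; rewrite // eab.
pose mu h := roots_unity F h :\ 1.
have card_mu h : (0 < h)%N -> (#|mu h| <= h.-1)%N.
  move=> h_gt0; have := card_roots_unity_le F h_gt0.
  by rewrite (cardsD1 1) inE expr1n eqxx -/(mu h) add1n; case: h h_gt0.
apply: leq_trans (_ : #|setX (mu h1) (mu h2)| <= _)%N; last first.
  by rewrite cardsX leq_mul ?card_mu.
(* The ratios x = a / b and y = (a + 1) / (b + 1) determine b, because
   b (x - y) = y - 1. *)
pose g (ab : F * F) := (ab.1 / ab.2, (ab.1 + 1) / (ab.2 + 1)).
have Eoff ab : ab \in E :\: diag -> [/\ ab.1 != ab.2, ab.2 != 0, ab.2 + 1 != 0 &
    ab.1 ^+ h1 = ab.2 ^+ h1 /\ (ab.1 + 1) ^+ h2 = (ab.2 + 1) ^+ h2].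
  rewrite !inE => /andP [nab /and3P [_ /andP [b0 b1]]].
  by rewrite xpair_eqE => /andP [/eqP e1 /eqP e2]; split.
have g_inj : {in E :\: diag &, injective g}.
  move=> [a b] [a' b'] /Eoff /= [nab b0 b1 _] /Eoff /= [nab' b0' b1' _].
  rewrite /g /= => -[ex ey].
  pose x := a / b; pose y := (a + 1) / (b + 1).
  have ea : a = x * b by rewrite /x divfK.
  have ea' : a' = x * b' by rewrite /x ex divfK.
  have key t : t != 0 -> t + 1 != 0 -> forall s, s = x * t ->
      y = (s + 1) / (t + 1) -> t * (x - y) = y - 1.
    move=> t0 t1 s es ->; rewrite es; field; exact: t1.
  have eb := key b b0 b1 a ea erefl.
  have eb' := key b' b0' b1' a' ea' ey.
  have xy : x - y != 0.
    apply: contra nab => /eqP xy; move: eb; rewrite xy mulr0 => /eqP.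
    rewrite eq_sym subr_eq0 => /eqP y1; move: xy; rewrite y1 => /eqP.
    by rewrite subr_eq0 ea => /eqP ->; rewrite mul1r.
  have ebb : b = b' by apply: (mulIf xy); rewrite eb eb'.
  by rewrite ea ea' ebb.
rewrite -(card_in_imset g_inj); apply/subset_leq_card/subsetP.
move=> _ /imsetP [[a b] /Eoff /= [nab b0 b1 [e1 e2]] ->].
rewrite /g !inE /= !expr_div_n e1 e2 !divff ?expf_neq0 // !eqxx !andbT.
apply/andP; split; apply: contra nab.
  by move/eqP => e; rewrite -[a](divfK b0) e mul1r.
by move/eqP => e; rewrite -(inj_eq (addIr 1)) -[a + 1](divfK b1) e mul1r.
Qed.

(** * Mean-square equidistribution of the levels *)

Lemma expf_card_pred (F : finFieldType) (x : F) : x != 0 -> x ^+ #|F|.-1 = 1.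
Proof.
move=> x0; apply: (mulfI x0); rewrite mulr1 -exprS prednK ?expf_card //.
exact: ltnW (card_finNzRing_gt1 F).
Qed.

(** The main term h1 h2 of the second moment cancels against that of rho (n - 1) = (n - 1)^2/(k1
    k2). What remains is at most n because h1/k2 = h2/k1 is at most both [h1] and [h2]. *)
Lemma variance_numeric (R : realFieldType) (n k1 h1 k2 h2 s c : R) :
    1 <= n -> 1 <= k1 -> 1 <= h1 -> 1 <= k2 -> 1 <= h2 ->
    k1 * h1 = n -> k2 * h2 = n ->
    s <= (n - 1) + (h1 - 1) * (h2 - 1) -> c <= k1 * k2 ->
  let rho := (n - 1) / (k1 * k2) in
  s - 2 * rho * (n - 1) + rho ^+ 2 * c <= n.
Proof.
move=> en ek1 eh1 ek2 eh2 en1 en2 s_le c_le /=; set rho := _ / _.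
have k1_neq0 : k1 != 0 by lra.
have k2_neq0 : k2 != 0 by lra.
have le_rho : rho ^+ 2 * c <= rho * (n - 1).
  have -> : rho * (n - 1) = rho ^+ 2 * (k1 * k2).
    by rewrite /rho; field; rewrite k1_neq0 k2_neq0.
  by rewrite ler_wpM2l // sqr_ge0.
have rhoE : rho * (n - 1) = h1 * h2 - 2 * (h1 / k2) + (k1 * k2)^-1.
  have -> : h2 = n / k2 by rewrite -en2 mulrAC divff ?mul1r.
  have -> : h1 = n / k1 by rewrite -en1 mulrAC divff ?mul1r.
  by rewrite /rho; field; rewrite k1_neq0 k2_neq0.
have le1 : h1 / k2 <= h1 by rewrite ler_pdivrMr; nra.
have le2 : h1 / k2 <= h2 by rewrite ler_pdivrMr; nra.
have inv_ge0 : 0 <= (k1 * k2)^-1 by rewrite invr_ge0; nra.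
lra.
Qed.

(** Every a other than 0 and -1 falls in a level indexed by roots of unity of orders dividing [k1]
    and [k2], so the first moment is exactly n - 1. With the bound on the second moment, expanding
    the square gives the claim. *)
Lemma variance_level (F : finFieldType) (n k1 h1 k2 h2 : nat) :
    n = #|F|.-1 -> (k1 * h1 = n)%N -> (k2 * h2 = n)%N ->
  \sum_(p in setX (roots_unity F k1) (roots_unity F k2))
     (#|level h1 h2 p|%:R - (n%:R - 1) / (k1%:R * k2%:R)) ^+ 2 <= n%:R :> rat.
Proof.
move=> def_n kh1 kh2.
have n_gt0 : (0 < n)%N.
  by have := card_finNzRing_gt1 F; rewrite def_n; case: #|F| => [|[]].
have [k1_gt0 h1_gt0] : (0 < k1 /\ 0 < h1)%N.
  by apply/andP; rewrite -muln_gt0 kh1.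
have [k2_gt0 h2_gt0] : (0 < k2 /\ 0 < h2)%N.
  by apply/andP; rewrite -muln_gt0 kh2.
set P := setX _ _; pose x p : rat := #|@level F h1 h2 p|%:R.
set rho := _ / _.
have natrP k : (0 < k)%N -> k.-1%:R = k%:R - 1 :> rat.
  by case: k => // k _; rewrite -natr1 addrK.
have sum1 : \sum_(p in P) x p = n%:R - 1.
  rewrite -natrP // def_n -card_neq0_neqN1 -natr_sum; congr _%:R.
  rewrite -[RHS]sum1_card.
  rewrite (partition_big (fun a : F => (a ^+ h1, (a + 1) ^+ h2)) (mem P)) /=.
    apply: eq_bigr => p _; rewrite sum1_card; apply: eq_card => a.
    by rewrite [in RHS]unfold_in /= !inE -andbA; case: p.
  move=> a; rewrite !inE /= => /andP [a0 a1].
  by rewrite -!exprM ![(_ * k1)%N]mulnC ![(_ * k2)%N]mulnC kh1 kh2 def_n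
    !expf_card_pred // !eqxx.
have sum2 : \sum_(p in P) x p ^+ 2 <= (n%:R - 1) + (h1%:R - 1) * (h2%:R - 1).
  have := sum_sq_level F h1_gt0 h2_gt0.
  rewrite -def_n -(ler_nat rat) natrD natrM !natrP // => le2.
  apply: le_trans le2; rewrite natr_sum [leRHS](bigID (mem P)) /=.
  rewrite -[leLHS]addr0 lerD ?sumr_ge0 //.
  by apply: ler_sum => p _; rewrite natrX.
have cardP : #|P|%:R <= k1%:R * k2%:R :> rat.
  by rewrite -natrM ler_nat cardsX leq_mul ?card_roots_unity_le.
have -> : \sum_(p in P) (x p - rho) ^+ 2
    = \sum_(p in P) x p ^+ 2 - 2 * rho * (\sum_(p in P) x p)
      + rho ^+ 2 * #|P|%:R.
  have -> : rho ^+ 2 * #|P|%:R = \sum_(p in P) rho ^+ 2.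
    by rewrite sumr_const mulr_natr.
  rewrite mulr_sumr -sumrB -big_split /=; apply: eq_bigr => p _; ring.
rewrite sum1.
apply: variance_numeric sum2 cardP; rewrite ?ler1n // -natrM ?kh1 ?kh2 //.
Qed.

(** * Counting pairs whose two products lie in given subgroups *)

Lemma prim_root_neq0 (F : fieldType) (n : nat) (w : F) :
  n.-primitive_root w -> w != 0.
Proof.
move=> prim_w; apply/eqP => w0; have := prim_expr_order prim_w.
by move/eqP; rewrite w0 expr0n -[n]prednK ?(prim_order_gt0 prim_w) //
  eq_sym oner_eq0.
Qed.

(** The solutions form the coset of w^h modulo the e-th roots of unity, of which there are exactly
    [e] since [e] divides [n]. *)
Lemma card_nth_roots (F : finFieldType) (n d e h : nat) (w : F) :
    n.-primitive_root w -> (d * (e * h))%N = n ->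
  #|[set u : F | u ^+ e == w ^+ (e * h)]| = e.
Proof.
move=> prim_w def_n; set z := w ^+ _.
have n_gt0 := prim_order_gt0 prim_w.
have e_dvd : (e %| n)%N by rewrite -def_n dvdn_mull ?dvdn_mulr.
have w_neq0 : w ^+ h != 0.
  by rewrite expf_neq0 // (prim_root_neq0 prim_w).
rewrite -[RHS](card_roots_unity (dvdn_prim_root prim_w e_dvd)).
rewrite -[RHS](card_imset _ (mulfI w_neq0)); apply: eq_card => u.
rewrite !inE; apply/eqP/imsetP => [ue | [v]].
  exists (u / w ^+ h); last by rewrite mulrC divfK.
  by rewrite inE expr_div_n ue -exprM mulnC divff // expf_neq0 //
     (prim_root_neq0 prim_w).
by rewrite inE => /eqP ve ->; rewrite exprMn ve mulr1 -exprM mulnC.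
Qed.

Definition coset_pairs (F : finFieldType) (m : nat) (z : F) : {set F} :=
  [set a | (a ^+ m == z) && ((a + 1) ^+ m == z)].

(** With rho = (n - 1)/d^2 the expected value of [A], this is A^2 - (A - rho)^2: a lower
    approximation to A^2 that is linear in [A], in the form produced by the correlation estimate. *)
Definition main_term (n d A : nat) : rat :=
  let rho := (n%:R - 1) / d%:R ^+ 2 in 2 * rho * A%:R - rho ^+ 2.

(** In the application [U] = c^(d-2) and [V] = (c+1)^(d-2), so the two products are those of all
    coefficients of f and of f + id. *)
Definition pairs_in_powers (F : finFieldType) (A : {set F}) (U V : F)
    (h1 h2 : nat) : {set F * F} :=
  [set ab | [&& ab.1 \in A, ab.2 \in A, (ab.1 * ab.2 * U) ^+ h1 == 1
             & ((ab.1 + 1) * (ab.2 + 1) * V) ^+ h2 == 1]].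

(** Sort the pairs by the class p of a under (a^h1, (a+1)^h2). The class of b is then forced to be
    s(p) for a permutation s of the set [K] of classes occurring in [A], so the count is a
    correlation over [K], and its error is bounded by the variance of the levels. *)
Lemma card_pairs_in_powers (F : finFieldType) (n d m e1 h1 e2 h2 : nat)
    (w U V : F) (A : {set F}) :
    n.-primitive_root w -> n = #|F|.-1 -> (d * m)%N = n ->
    (e1 * h1 = m)%N -> (e2 * h2 = m)%N ->
    U ^+ m * w ^+ m ^+ 2 = 1 -> V ^+ m * w ^+ m ^+ 2 = 1 ->
    A = coset_pairs m (w ^+ m) ->
  `|#|pairs_in_powers A U V h1 h2|%:R - main_term n d #|A| / (e1%:R * e2%:R)|
    <= n%:R.
Proof.
move=> prim_w def_n dm eh1 eh2; set z := w ^+ m => Um Vm def_A.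
have n_gt0 := prim_order_gt0 prim_w.
have [d_gt0 m_gt0] : (0 < d /\ 0 < m)%N by apply/andP; rewrite -muln_gt0 dm.
have [e1_gt0 h1_gt0] : (0 < e1 /\ 0 < h1)%N.
  by apply/andP; rewrite -muln_gt0 eh1.
have [e2_gt0 h2_gt0] : (0 < e2 /\ 0 < h2)%N.
  by apply/andP; rewrite -muln_gt0 eh2.
have z_neq0 : z != 0.
  by rewrite expf_neq0 // (prim_root_neq0 prim_w).
have U_neq0 : U != 0.
  by apply/eqP => U0; move/eqP: Um; rewrite U0 expr0n -[m]prednK //
    mul0r eq_sym oner_eq0.
have V_neq0 : V != 0.
  by apply/eqP => U0; move/eqP: Vm; rewrite U0 expr0n -[m]prednK //
    mul0r eq_sym oner_eq0.
pose K := setX [set u : F | u ^+ e1 == z] [set u : F | u ^+ e2 == z].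
have cardK : #|K|%:R = e1%:R * e2%:R :> rat.
  rewrite -natrM cardsX /z -{1}eh1 -eh2.
  by rewrite (card_nth_roots prim_w (d := d)) ?eh1 //
     (card_nth_roots prim_w (d := d)) ?eh2.
pose phi (a : F) := (a ^+ h1, (a + 1) ^+ h2).
(* [s] sends the class of [a] to the class that [b] must have for both products
   to satisfy the power conditions. *)
pose s (p : F * F) := ((p.1 * U ^+ h1)^-1, (p.2 * V ^+ h2)^-1).
pose x p : rat := #|@level F h1 h2 p|%:R.
have s_inj : injective s.
  move=> [u v] [u' v'] [] /invr_inj /(mulIf (expf_neq0 _ U_neq0)) ->.
  by move/invr_inj/(mulIf (expf_neq0 _ V_neq0)) ->.
(* The hypotheses on [U] and [V] enter here: they make [s] map [K] into itself. *)
have zU : (z * U ^+ m)^-1 = z.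
  by apply: mulr1_eq; ring: Um.
have zV : (z * V ^+ m)^-1 = z.
  by apply: mulr1_eq; ring: Vm.
have sK : {in K, forall p, s p \in K}.
  move=> [u v]; rewrite !inE /= => /andP [/eqP ue /eqP ve].
  rewrite !exprVn !exprMn ue ve -!exprM ![(h1 * _)%N]mulnC ![(h2 * _)%N]mulnC.
  by rewrite eh1 eh2 zU zV eqxx.
have A_phi a : (a \in A) = [&& a != 0, a + 1 != 0 & phi a \in K].
  rewrite def_A !inE /= -!exprM ![(h1 * _)%N]mulnC ![(h2 * _)%N]mulnC eh1 eh2.
  have [-> | ] := eqVneq a 0.
    by rewrite expr0n -[m]prednK // eq_sym (negPf z_neq0).
  have [-> | //] := eqVneq (a + 1) 0.
  by rewrite expr0n -[m]prednK // [0 == z]eq_sym (negPf z_neq0) andbF.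
have levelE a p : (a \in level h1 h2 p) = [&& a != 0, a + 1 != 0 & phi a == p].
  by rewrite inE; case: p.
have sumA : \sum_(p in K) x p = #|A|%:R.
  rewrite -natr_sum -[in RHS]sum1_card; congr _%:R.
  rewrite [RHS](partition_big phi (mem K)) /=; last first.
    by move=> a; rewrite A_phi => /and3P [].
  apply: eq_bigr => p pK; rewrite sum1_card; apply: eq_card => a.
  rewrite -[RHS]/((a \in A) && (phi a == p)) A_phi levelE -!andbA.
  have [e | ne] := eqVneq (phi a) p.
    by rewrite e pK.
  by rewrite !andbF.
have sumN : \sum_(p in K) x p * x (s p) = #|pairs_in_powers A U V h1 h2|%:R.
  under eq_bigr do rewrite -natrM.
  rewrite -natr_sum -[in RHS]sum1_card; congr _%:R.
  rewrite [RHS](partition_big (fun ab => phi ab.1) (mem K)) /=; last first.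
    move=> ab; rewrite [_ \in pairs_in_powers _ _ _ _ _]inE A_phi.
    by move=> /andP [/and3P []].
  apply: eq_bigr => p pK; rewrite sum1_card -cardsX; apply: eq_card => -[a b].
  rewrite -[RHS]/(((a, b) \in pairs_in_powers A U V h1 h2) && (phi a == p)).
  rewrite [in RHS]inE in_setX /= !levelE !A_phi.
  have [phi_a | ne] := eqVneq (phi a) p; last by rewrite !andbF.
  have eq_inv (u v : F) : u != 0 -> (v == u^-1) = (u * v == 1).
    by move=> u0; apply/eqP/eqP => [->|/mulr1_eq //]; rewrite divff.
  have [-> //| a0] := eqVneq a 0; have [-> //| a1] := eqVneq (a + 1) 0.
  have [-> | b0] := eqVneq b 0; first by rewrite !andbF.
  have [-> | b1] := eqVneq (b + 1) 0; first by rewrite !andbF.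
  rewrite phi_a pK /= andbT.
  have eqS : ((a * b * U) ^+ h1 == 1)
      && (((a + 1) * (b + 1) * V) ^+ h2 == 1) = (phi b == s p).
    rewrite -phi_a xpair_eqE /= !eq_inv ?mulf_neq0 ?expf_neq0 // -!exprMn.
    by rewrite [in RHS]mulrAC ![_ * V]mulrAC.
  (* Membership of b in [A] follows from the class condition, as [s p] lies in [K]. *)
  by rewrite eqS; case: eqP => [->|_]; rewrite ?sK ?andbF.
(* The levels now refer to subgroups of index d e1 and d e2, which fixes this value of rho. *)
have close := sum_mul_perm_close x
  ((n%:R - 1) / ((d * e1)%:R * (d * e2)%:R)) (in2W s_inj) sK.
rewrite sumN sumA cardK in close.
have -> : main_term n d #|A| / (e1%:R * e2%:R)
    = 2 * ((n%:R - 1) / ((d * e1)%:R * (d * e2)%:R)) * #|A|%:R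
      - ((n%:R - 1) / ((d * e1)%:R * (d * e2)%:R)) ^+ 2 * (e1%:R * e2%:R) :> rat.
  rewrite /main_term !natrM.
  have d0 : d%:R != 0 :> rat by rewrite pnatr_eq0 -lt0n.
  have e10 : e1%:R != 0 :> rat by rewrite pnatr_eq0 -lt0n.
  have e20 : e2%:R != 0 :> rat by rewrite pnatr_eq0 -lt0n.
  by field; rewrite d0 e10 e20.
apply: (le_trans close).
have var := variance_level (F := F) (n := n) (k1 := d * e1) (h1 := h1)
  (k2 := d * e2) (h2 := h2) def_n.
rewrite -!mulnA eh1 eh2 in var.
apply: (le_trans _ (var dm dm)).
(* [K] is only part of the index set of the variance; the other terms are nonnegative. *)
rewrite [leRHS](bigID (mem K)) /= -[leLHS]addr0 lerD //; last first.
  by apply: sumr_ge0 => p _; apply: sqr_ge0.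
rewrite le_eqVlt; apply/orP; left; apply/eqP; apply: eq_bigl => p.
rewrite andbC; case pK : (p \in K) => //=; move: pK.
have zd : z ^+ d = 1 by rewrite -exprM mulnC dm (prim_expr_order prim_w).
rewrite !inE => /andP [/eqP e1' /eqP e2'].
by rewrite ![(d * _)%N]mulnC !exprM e1' e2' zd eqxx.
Qed.

(** * Inclusion-exclusion over the primes dividing m *)

Lemma prod_primes_dvdn (s : seq nat) (t : nat) :
  uniq s -> all prime s -> (\prod_(p <- s) p %| t)%N = all (dvdn^~ t) s.
Proof.
elim: s => [|p s IHs] /=; first by rewrite big_nil dvd1n.
move=> /andP [p_s uniq_s] /andP [p_pr s_pr]; rewrite big_cons -IHs //.
apply: Gauss_dvd; rewrite prime_coprime // Euclid_dvd_prod // big_has.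
apply: contra p_s => /hasP [r r_s]; have r_pr := allP s_pr r r_s.
by rewrite dvdn_prime2 // => /eqP ->.
Qed.

(** These are the squarefree divisors of [m] when m > 0. Indexing them by sets of positions in
    [primes m] lets a product over primes be expanded by distributivity, with (-1)^|I| as Möbius
    function. *)
Definition prime_prod (m : nat) (I : {set 'I_(size (primes m))}) : nat :=
  \prod_(i in I) nth 0%N (primes m) i.

Lemma prime_prod_dvdn (m t : nat) (I : {set 'I_(size (primes m))}) :
  (prime_prod I %| t)%N = [forall i in I, nth 0 (primes m) i %| t]%N.
Proof.
pose s := [seq nth 0%N (primes m) (val i) | i <- enum I].
have -> : prime_prod I = (\prod_(p <- s) p)%N by rewrite big_map big_enum.
rewrite prod_primes_dvdn.
- apply/allP/forall_inP => [h i Ii | h _ /mapP [i + ->]].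
    by apply: h; apply: map_f; rewrite mem_enum.
  by rewrite mem_enum; apply: h.
- rewrite map_inj_uniq ?enum_uniq // => i j /eqP.
  by rewrite nth_uniq ?primes_uniq ?ltn_ord // => /eqP /val_inj.
apply/allP => _ /mapP [i _ ->].
by have := mem_nth 0%N (ltn_ord i); rewrite mem_primes => /andP [].
Qed.

(** If x has order o and t = m/o, then x^(m/k) = 1 iff k divides t, for k dividing m. So primitivity
    means t = 1, whose indicator is the product of 1 - [p divides t] over the primes p dividing
    m. *)
Lemma prim_root_sieve (F : fieldType) (m : nat) (x : F) :
    (0 < m)%N -> x ^+ m = 1 ->
  (m.-primitive_root x)%:R
    = \sum_(I : {set 'I_(size (primes m))})
        (-1) ^+ #|I| * (x ^+ (m %/ prime_prod I) == 1)%:R :> rat.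
Proof.
move=> m_gt0 xm; have [o prim_x o_dvd] := prim_order_exists m_gt0 xm.
pose t := (m %/ o)%N.
have expE k : (k %| m)%N -> (x ^+ (m %/ k) == 1) = (k %| t)%N.
  by move=> k_dvd; rewrite -(prim_order_dvd prim_x) !dvdn_divRL // mulnC.
pose p i := nth 0%N (primes m) i.
have p_dvd (i : 'I_(size (primes m))) : [/\ prime (p i) & (p i %| m)%N].
  by have := mem_nth 0%N (ltn_ord i); rewrite mem_primes => /and3P [].
have -> : (m.-primitive_root x)%:R
    = \prod_(i < size (primes m)) (- (p i %| t)%:R + 1) :> rat.
  have [om | ] := eqVneq o m.
    have prim_m : m.-primitive_root x by rewrite -om.
    rewrite prim_m big1 // => i _; have [p_pr _] := p_dvd i.
    by rewrite /t om divnn m_gt0 dvdn1 gtn_eqF ?prime_gt1 // oppr0 add0r.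
  move=> ne_om.
  have t_gt1 : (1 < t)%N.
    rewrite ltn_neqAle divn_gt0 ?(prim_order_gt0 prim_x) // dvdn_leq // andbT.
    by rewrite eq_sym; apply: contra ne_om => /eqP t1;
      rewrite -(divnK o_dvd) -/t t1 mul1n.
  (* A prime factor of t > 1 divides m, and its factor in the product vanishes. *)
  have q_in : pdiv t \in primes m.
    rewrite mem_primes pdiv_prime // m_gt0 /=.
    by apply: dvdn_trans (pdiv_dvd t) _; rewrite -(divnK o_dvd) dvdn_mulr.
  have q_lt : (index (pdiv t) (primes m) < size (primes m))%N by rewrite index_mem.
  rewrite (bigD1 (Ordinal q_lt)) //= /p nth_index // pdiv_dvd addNr mul0r.
  apply/eqP; rewrite pnatr_eq0 eqb0; apply: contra ne_om => prim_m.
  by rewrite eqn_dvd o_dvd (prim_order_dvd prim_m) (prim_expr_order prim_x) eqxx.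
rewrite bigA_distr; apply: eq_bigr => I _.
have W_dvd : (prime_prod I %| m)%N.
  by rewrite prime_prod_dvdn; apply/forall_inP => i _; have [] := p_dvd i.
rewrite expE // prime_prod_dvdn -big_mkcond /= prodrN; congr (_ * _).
have [/forall_inP h | ] := boolP [forall i in I, p i %| t]%N.
  by rewrite big1 // => i /h ->.
rewrite negb_forall => /existsP [i]; rewrite negb_imply => /andP [Ii /negPf pt].
by rewrite (bigD1 i) //= /p pt mul0r.
Qed.

(** For m > 0 this is phi(m)/m, written as the sum of mu(e)/e over the divisors e of [m]. *)
Definition sieve_density (m : nat) : rat :=
  \sum_(I : {set 'I_(size (primes m))}) (-1) ^+ #|I| / (prime_prod I)%:R.

(** The Euler product has factors 1 - 1/p, each at least 1/2. *)
Lemma sieve_density_ge (m : nat) :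
  (2%:R ^+ size (primes m))^-1 <= sieve_density m.
Proof.
pose p i := nth 0%N (primes m) i.
have -> : sieve_density m
    = \prod_(i < size (primes m)) (- (p i)%:R^-1 + 1) :> rat.
  rewrite bigA_distr; apply: eq_bigr => I _.
  by rewrite -big_mkcond /= prodrN prodfV -natr_prod.
rewrite -exprVn -[X in _ ^+ X]card_ord -prodr_const; apply: ler_prod => i _.
have : (1 < p i)%N.
  by have := mem_nth 0%N (ltn_ord i); rewrite mem_primes => /andP [/prime_gt1].
rewrite -(ler_nat rat) => p_ge2; rewrite invr_ge0 ler0n /=.
have : (p i)%:R^-1 <= 2^-1 :> rat by rewrite lef_pV2 ?posrE //; lra.
lra.
Qed.

Definition primitive_pairs (F : finFieldType) (m : nat) (A : {set F})
    (U V : F) : {set F * F} :=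
  [set ab | [&& ab.1 \in A, ab.2 \in A, m.-primitive_root (ab.1 * ab.2 * U)
             & m.-primitive_root ((ab.1 + 1) * (ab.2 + 1) * V)]].

(** Sieving both products gives 4^omega(m) signed counts, each with error at most n, where omega(m)
    is the number of primes dividing m; their main terms factor into the square of the density. *)
Lemma card_primitive_pairs (F : finFieldType) (n d m : nat)
    (w U V : F) (A : {set F}) :
    n.-primitive_root w -> n = #|F|.-1 -> (d * m)%N = n ->
    U ^+ m * w ^+ m ^+ 2 = 1 -> V ^+ m * w ^+ m ^+ 2 = 1 ->
    A = coset_pairs m (w ^+ m) ->
  `|#|primitive_pairs m A U V|%:R - main_term n d #|A| * sieve_density m ^+ 2|
    <= 4 ^+ size (primes m) * n%:R.
Proof.
move=> prim_w def_n dm Um Vm def_A.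
have n_gt0 := prim_order_gt0 prim_w.
have m_gt0 : (0 < m)%N by move: n_gt0; rewrite -dm muln_gt0 => /andP [].
pose T := {set 'I_(size (primes m))}.
pose N (I J : T) : rat :=
  #|pairs_in_powers A U V (m %/ prime_prod I) (m %/ prime_prod J)|%:R.
have W_dvd (I : T) : (prime_prod I %| m)%N.
  rewrite prime_prod_dvdn; apply/forall_inP => i _.
  by have := mem_nth 0%N (ltn_ord i); rewrite mem_primes => /and3P [].
have closeN (I J : T) : `|N I J - main_term n d #|A| /
    ((prime_prod I)%:R * (prime_prod J)%:R)| <= n%:R.
  by apply: (card_pairs_in_powers prim_w def_n dm _ _ Um Vm def_A);
     rewrite mulnC divnK.
have expand : #|primitive_pairs m A U V|%:R
    = \sum_(I : T) \sum_(J : T) (-1) ^+ #|I| * (-1) ^+ #|J| * N I J.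
  have -> : #|primitive_pairs m A U V|%:R = \sum_(ab in setX A A)
      (m.-primitive_root (ab.1 * ab.2 * U))%:R
      * (m.-primitive_root ((ab.1 + 1) * (ab.2 + 1) * V))%:R :> rat.
    rewrite -sum1_card natr_sum [RHS]big_mkcond [LHS]big_mkcond /=.
    apply: eq_bigr => -[a b] _; rewrite !inE /=.
    by case: (a \in A); case: (b \in A) => //=;
      do 2 case: (_.-primitive_root _).
  transitivity (\sum_(ab in setX A A) \sum_(I : T) \sum_(J : T)
      (-1) ^+ #|I| * (-1) ^+ #|J|
      * ((ab.1 * ab.2 * U) ^+ (m %/ prime_prod I) == 1)%:R
      * (((ab.1 + 1) * (ab.2 + 1) * V) ^+ (m %/ prime_prod J) == 1)%:R : rat).
    apply: eq_bigr => -[a b]; rewrite def_A !inE /=.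
    move=> /andP [/andP [/eqP am /eqP a1m] /andP [/eqP bm /eqP b1m]].
    have Pm : (a * b * U) ^+ m = 1 by rewrite !exprMn am bm mulrC.
    have Qm : ((a + 1) * (b + 1) * V) ^+ m = 1 by rewrite !exprMn a1m b1m mulrC.
    rewrite !prim_root_sieve // big_distrlr /=.
    by apply: eq_bigr => I _; apply: eq_bigr => J _; rewrite mulrACA mulrA.
  rewrite exchange_big; apply: eq_bigr => I _ /=.
  rewrite exchange_big; apply: eq_bigr => J _ /=.
  rewrite /N -sum1_card natr_sum mulr_sumr big_mkcond [RHS]big_mkcond /=.
  apply: eq_bigr => -[a b] _; rewrite !inE /=.
  case: (a \in A); case: (b \in A) => //=.
  by do 2 case: (_ == 1); rewrite ?mulr1 ?mulr0.
have -> : main_term n d #|A| * sieve_density m ^+ 2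
    = \sum_(I : T) \sum_(J : T) (-1) ^+ #|I| * (-1) ^+ #|J|
       * (main_term n d #|A| / ((prime_prod I)%:R * (prime_prod J)%:R)).
  rewrite expr2 big_distrlr mulr_sumr; apply: eq_bigr => I _ /=.
  rewrite mulr_sumr; apply: eq_bigr => J _; rewrite invfM; ring.
rewrite expand -sumrB.
have -> : 4 ^+ size (primes m) * n%:R = \sum_(I : T) \sum_(J : T) n%:R :> rat.
  have cardT : #|T| = (2 ^ size (primes m))%N.
    by rewrite -cardsT -powersetT card_powerset cardsT card_ord.
  rewrite !sumr_const !cardT -mulrnA -[RHS]mulr_natr -expnD addnn -mul2n.
  by rewrite expnM natrX mulrC.
apply: (le_trans (ler_norm_sum _ _ _)); apply: ler_sum => I _.
rewrite -sumrB; apply: (le_trans (ler_norm_sum _ _ _)); apply: ler_sum => J _.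
by rewrite -mulrBr normrM normrM !normrX normrN1 !expr1n !mul1r.
Qed.

(** * Size estimates and the choice of a, b, c *)

(** At most b primes are below b, and they account for the factor b^b. Each other prime p dividing m
    satisfies b <= p, and the product of the distinct primes is at most m. *)
Lemma exp_size_primes_le (b m : nat) :
  (0 < m)%N -> (b ^ size (primes m) <= b ^ b * m)%N.
Proof.
move=> m_gt0; have [-> | b_gt0] := posnP b.
  by rewrite expn0 mul1n; case: (size _) => [|k]; rewrite ?expn0 ?exp0n.
have prod_le : (\prod_(p <- primes m) p <= m)%N.
  apply: dvdn_leq => //; rewrite prod_primes_dvdn ?primes_uniq //.
    by apply/allP => p; rewrite mem_primes => /and3P [].
  by apply/allP => p; rewrite mem_primes => /and3P [].
have count_le : (count (ltn^~ b) (primes m) <= b)%N.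
  rewrite -size_filter -[X in (_ <= X)%N](size_iota 0).
  apply: uniq_leq_size; first by rewrite filter_uniq ?primes_uniq.
  by move=> p; rewrite mem_filter mem_iota => /andP [].
apply: leq_trans (leq_mul (leq_pexp2l b_gt0 count_le) prod_le).
have : all (leq 1) (primes m).
  by apply/allP => p; rewrite mem_primes => /and3P [/prime_gt0].
elim: (primes m) => [|p s IHs] /=; first by rewrite big_nil.
move=> /andP [p_gt0 /IHs {}IHs]; rewrite big_cons expnS.
have [p_lt | b_le] := ltnP p b.
  rewrite add1n expnS -mulnA leq_mul2l; apply/orP; right.
  by apply: leq_trans IHs _; rewrite leq_mul2l leq_pmull ?orbT.
by rewrite add0n mulnCA leq_mul.
Qed.

Lemma exp_size_primes_small (b K : nat) :
  exists C, forall m, (C < m)%N -> (K * b ^ size (primes m) <= m)%N.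
Proof.
(* The previous bound for b^2 gives (K b^omega)^2 <= C m <= m^2, with omega the number of primes
   dividing m. *)
exists (K ^ 2 * (b ^ 2) ^ (b ^ 2))%N => m C_lt.
have m_gt0 : (0 < m)%N by apply: leq_ltn_trans C_lt.
have le := exp_size_primes_le (b ^ 2) m_gt0.
rewrite -leq_sqr expnMn -expnM [(_ * 2)%N]mulnC expnM.
apply: leq_trans (leq_mul (leqnn _) le) _.
by rewrite mulnA -mulnn leq_mul2r (ltnW C_lt) orbT.
Qed.

(** [A] is the level of (z, z) for h1 = h2 = m, so its deviation is a single term of the
    variance. *)
Lemma coset_pairs_variance (F : finFieldType) (n d m : nat) (w : F)
    (A : {set F}) :
    n.-primitive_root w -> n = #|F|.-1 -> (d * m)%N = n ->
    A = coset_pairs m (w ^+ m) ->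
  (#|A|%:R - (n%:R - 1) / d%:R ^+ 2) ^+ 2 <= n%:R :> rat.
Proof.
move=> prim_w def_n dm def_A; have n_gt0 := prim_order_gt0 prim_w.
have m_gt0 : (0 < m)%N by move: n_gt0; rewrite -dm muln_gt0 => /andP [].
set z := w ^+ m in def_A.
have z_neq0 : z != 0 by rewrite expf_neq0 // (prim_root_neq0 prim_w).
have zd : z ^+ d = 1 by rewrite -exprM mulnC dm (prim_expr_order prim_w).
have zP : (z, z) \in setX (roots_unity F d) (roots_unity F d).
  by rewrite !inE /= zd eqxx.
have levelA : level m m (z, z) = A.
  apply/setP => a; rewrite def_A !inE /=.
  have [-> | _] := eqVneq a 0.
    by rewrite expr0n -[m]prednK //= eq_sym (negPf z_neq0).
  have [-> | //] := eqVneq (a + 1) 0.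
  by rewrite expr0n -[m]prednK //= [0 == z]eq_sym (negPf z_neq0) andbF.
have := variance_level def_n dm dm; rewrite (bigD1 (z, z)) //= levelA expr2.
by apply: le_trans; rewrite lerDl sumr_ge0 // => p _; apply: sqr_ge0.
Qed.

(** Here x = |A|, W = 4^omega and G counts the primitive pairs. As r^2 >= 16 W^2 n, x is at least
    3r/4, so the main term is at least r^2/2 >= 8 W^2 n. After the factor delta^2 >= 1/W and the
    error W n, at least 7 W n remains, which exceeds n + 1 >= x. *)
Lemma sieve_numeric (R : realFieldType) (n d x W delta G : R) :
    1 <= d -> 1 <= W -> 64 * d ^+ 4 * W ^+ 2 <= n -> x <= n + 1 ->
    W^-1 <= delta ^+ 2 -> (x - (n - 1) / d ^+ 2) ^+ 2 <= n ->
    `|G - (2 * ((n - 1) / d ^+ 2) * x - ((n - 1) / d ^+ 2) ^+ 2) * delta ^+ 2|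
       <= W * n ->
  0 < x /\ x < G.
Proof.
set t := d ^+ 2; set r := (n - 1) / t => d_ge1 W_ge1 n_large x_le delta_ge
  var closeG.
have t_ge1 : 1 <= t by rewrite exprn_ege1.
have d4 : d ^+ 4 = t ^+ 2 by rewrite /t -exprM.
rewrite d4 in n_large.
have W2_ge1 : 1 <= W ^+ 2 by rewrite exprn_ege1.
have t2_ge1 : 1 <= t ^+ 2 by rewrite exprn_ege1.
have n_ge : 64 <= n.
  apply: le_trans n_large; rewrite -mulrA ler_peMr //.
  by rewrite -[X in X <= _]mulr1 ler_pM.
have r_t : r * t = n - 1 by rewrite /r divfK //; lra.
have r_large : 16 * W ^+ 2 * n <= r ^+ 2.
  have t2_gt0 : 0 < t ^+ 2 by lra.
  rewrite -(ler_pM2r t2_gt0) -exprMn r_t.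
  have : 64 * t ^+ 2 * W ^+ 2 * n <= n * n by rewrite ler_wpM2r //; lra.
  nra.
have r_gt0 : 0 < r by rewrite divr_gt0; lra.
have n_le : 16 * n <= r ^+ 2 by apply: le_trans r_large; nra.
have x_ge : 3 / 4 * r <= x by rewrite leNgt; apply/negP => x_lt; nra.
have M_ge : 8 * W ^+ 2 * n <= 2 * r * x - r ^+ 2 by nra.
have Md_ge : 8 * W * n <= (2 * r * x - r ^+ 2) * delta ^+ 2.
  have -> : 8 * W * n = 8 * W ^+ 2 * n * W^-1 by field; lra.
  apply: ler_pM => //; last by rewrite invr_ge0; lra.
  by rewrite !mulr_ge0 //; lra.
move: closeG; rewrite ler_norml => /andP [lower _].
have Wn : n <= W * n by rewrite ler_peMl //; lra.
by split; lra.
Qed.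

(** Any c in [A] will do: once it is fixed, there are more suitable pairs (a, b) than elements of
    [A], so one of them is off the diagonal. *)
Lemma exists_primitive_triple (d : nat) : (1 < d)%N ->
  exists C, forall (F : finFieldType) (n m : nat) (w : F),
    n.-primitive_root w -> n = #|F|.-1 -> (d * m)%N = n -> (C < m)%N ->
  exists a b c : F, let A := coset_pairs m (w ^+ m) in
    [/\ a != b, [/\ a \in A, b \in A & c \in A],
        m.-primitive_root (a * b * c ^+ d.-2) &
        m.-primitive_root ((a + 1) * (b + 1) * (c + 1) ^+ d.-2)].
Proof.
move=> d_gt1; have [C Cb] := exp_size_primes_small 16 (64 * d ^ 3).
exists C => F n m w prim_w def_n dm /Cb {Cb} m_large.
set z := w ^+ m; set A := coset_pairs m z.
have n_gt0 := prim_order_gt0 prim_w.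
have zd : z ^+ d = 1 by rewrite -exprM mulnC dm (prim_expr_order prim_w).
pose x : rat := #|A|%:R.
have [W def_W] : exists W : rat, W = 4 ^+ size (primes m) by eexists.
have W_ge1 : 1 <= W by rewrite def_W exprn_ege1 //; lra.
have delta_ge : W^-1 <= sieve_density m ^+ 2.
  have := sieve_density_ge m; set y := _^-1 => y_le.
  have -> : W^-1 = y ^+ 2.
    rewrite /y def_W exprVn -exprM mulnC exprM; congr (_ ^+ _)^-1; ring.
  have y_ge0 : 0 <= y by rewrite invr_ge0 exprn_ge0.
  by rewrite lerXn2r // nnegrE (le_trans y_ge0).
have x_le : x <= n%:R + 1.
  rewrite natr1 ler_nat def_n prednK ?max_card //.
  exact: ltnW (card_finNzRing_gt1 F).
have n_large : 64 * d%:R ^+ 4 * W ^+ 2 <= n%:R.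
  have := leq_mul (leqnn d) m_large; rewrite dm -(ler_nat rat).
  rewrite !natrM !natrX; apply: le_trans; rewrite def_W -exprM mulnC exprM.
  have -> : 4 ^+ 2 = 16 :> rat by ring.
  by rewrite le_eqVlt; apply/orP; left; apply/eqP; ring.
have {m_large n_large} numeric G := sieve_numeric (G := G) _ W_ge1 n_large
  x_le delta_ge (coset_pairs_variance prim_w def_n dm erefl).
have d_ge1 : 1 <= d%:R :> rat by rewrite ler1n ltnW.
have A_gt0 : (0 < #|A|)%N.
  (* The count of pairs depends on c, which is not yet chosen. Putting the main term itself in place
     of [G] still yields that [A] is nonempty. *)
  have [|+ _] := numeric d_ge1 (main_term n d #|A| * sieve_density m ^+ 2).
    rewrite subrr normr0 mulr_ge0 //; lra.
  by rewrite ltr0n.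
have [c cA] : exists c, c \in A by apply/set0Pn; rewrite -card_gt0.
have /andP [/eqP cm /eqP c1m] : (c ^+ m == z) && ((c + 1) ^+ m == z).
  by move: cA; rewrite inE.
(* The exponents d - 2 and 2 add up to d, and z^d = 1. *)
have Uz (y : F) : y ^+ m = z -> (y ^+ d.-2) ^+ m * z ^+ 2 = 1.
  by move=> ym; rewrite exprAC ym -exprD addn2 -[RHS]zd;
     congr (_ ^+ _); lia.
have := card_primitive_pairs prim_w def_n dm (Uz c cm) (Uz _ c1m) erefl.
set G := primitive_pairs _ _ _ _; rewrite -def_W -/z -/A => closeG.
have G_gt : (#|A| < #|G|)%N.
  by have [_] := numeric d_ge1 #|G|%:R closeG; rewrite ltr_nat.
have [[a b] abG nab] : exists2 ab, ab \in G & ab.1 != ab.2.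
  apply/exists_inP; apply: contraLR G_gt; rewrite negb_exists_in -leqNgt.
  move=> /forall_inP diag.
  rewrite -(card_imset (mem A) (f := fun a => (a, a))); last by move=> u v [].
  apply/subset_leq_card/subsetP => -[a b] abG; apply/imsetP.
  have := diag _ abG; rewrite negbK => /eqP /= eab; exists a; last by rewrite eab.
  by move: abG; rewrite inE => /andP [].
move: abG; rewrite inE /= => /and4P [aA bA P Q].
by exists a, b, c; split.
Qed.

(** * Cyclicity and non-additivity of maps given by coset coefficients *)

Lemma prim_root_expr (F : fieldType) (n d m : nat) (w : F) :
  n.-primitive_root w -> (d * m)%N = n -> d.-primitive_root (w ^+ m).
Proof.
move=> prim_w dm; have n_gt0 := prim_order_gt0 prim_w.
have d_gt0 : (0 < d)%N by move: n_gt0; rewrite -dm muln_gt0 => /andP [].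
have d_dvd : (d %| n)%N by rewrite -dm dvdn_mulr.
by have := dvdn_prim_root prim_w d_dvd; rewrite -dm mulKn.
Qed.

(** Each step multiplies x^m by z, so d steps return to the same coset and multiply by the product
    [P] of all coefficients. As [P] generates the m-th roots of unity, the orbit of 1 fills every
    coset. *)
Lemma coset_map_cyclic (F : finFieldType) (n d m : nat) (w : F)
    (k h : F -> F) :
    n.-primitive_root w -> n = #|F|.-1 -> (d * m)%N = n ->
    (forall x, h x = k (x ^+ m) * x) ->
    (forall i, (i < d)%N -> k (w ^+ m ^+ i) ^+ m = w ^+ m) ->
    m.-primitive_root (\prod_(i < d) k (w ^+ m ^+ i)) ->
  permutes_nonzero_cyclically h.
Proof.
set z := w ^+ m => prim_w def_n dm hE km; set P := \prod_(i < d) _ => prim_P.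
have n_gt0 := prim_order_gt0 prim_w.
have [d_gt0 m_gt0] : (0 < d /\ 0 < m)%N by apply/andP; rewrite -muln_gt0 dm.
have z_neq0 : z != 0 by rewrite expf_neq0 // (prim_root_neq0 prim_w).
have prim_z : d.-primitive_root z by apply: prim_root_expr dm.
have classE x : x != 0 -> exists i, x ^+ m = z ^+ i.
  move=> x0; have [|i ->] := prim_rootP prim_z (x := x ^+ m); last by exists i.
  by rewrite -exprM mulnC dm def_n expf_card_pred.
have kz i : k (z ^+ i) ^+ m = z.
  by rewrite -(prim_expr_mod prim_z) km // ltn_mod.
have kz_neq0 i : k (z ^+ i) != 0.
  by apply: contra z_neq0 => /eqP k0; rewrite -(kz i) k0 expr0n -[m]prednK.
have h0 : h 0 = 0 by rewrite hE mulr0.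
have h_neq0 x : x != 0 -> h x != 0.
  by move=> x0; rewrite hE; have [i ->] := classE x x0; rewrite mulf_neq0.
have h_inj : injective h.
  move=> x y; have [-> | x0] := eqVneq x 0; have [-> | y0] := eqVneq y 0 => //.
  - by rewrite h0 => /esym/eqP; rewrite (negPf (h_neq0 _ y0)).
  - by rewrite h0 => /eqP; rewrite (negPf (h_neq0 _ x0)).
  move=> hxy; have [i xi] := classE x x0; have [j yj] := classE y y0.
  have xy : x ^+ m = y ^+ m.
    have := congr1 (fun u => u ^+ m) hxy.
    by rewrite !hE !exprMn xi yj !kz => /(mulfI z_neq0).
  by move: hxy; rewrite !hE -xy xi => /(mulfI (kz_neq0 i)).
pose B j := iter j h 1.
have Bm j : B j ^+ m = z ^+ j.
  elim: j => [|j IHj]; first by rewrite expr1n.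
  by rewrite /B iterS hE exprMn -/(B j) IHj kz exprS.
have BS j : B j.+1 = k (z ^+ j) * B j by rewrite -Bm -hE.
have Bd : B d = P.
  rewrite /P; elim: (d) => [|j IHj]; first by rewrite big_ord0.
  by rewrite BS IHj big_ord_recr mulrC.
have BDd j : B (j + d)%N = P * B j.
  elim: j => [|j IHj]; first by rewrite Bd mulr1.
  by rewrite addSn !BS IHj exprD (prim_expr_order prim_z) mulr1 mulrCA.
have BDmul j t : B (j + t * d)%N = P ^+ t * B j.
  elim: t => [|t IHt]; first by rewrite addn0 mul1r.
  by rewrite mulSn addnCA addnC BDd IHt exprS mulrA.
have B_neq0 j : B j != 0.
  by elim: j => [|j IHj]; [exact: oner_neq0 | rewrite /B iterS h_neq0].
have orbitE : fingraph.orbit h 1 =i [pred x | x != 0].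
  move=> y; rewrite -fconnect_orbit inE; apply/idP/idP => [/iter_findex <- // | y0].
    exact: B_neq0.
  (* If y lies in the coset of B_i, then y/B_i is a power P^t, so y is the iterate of index i + t
     d. *)
  have [i yi] := classE y y0.
  have [|t Pt] := prim_rootP prim_P (x := y / B i).
    by rewrite expr_div_n yi Bm divff // expf_neq0.
  by rewrite -(divfK (B_neq0 i) y) Pt -BDmul fconnect_iter.
split => //; first exact: injF_bij.
exists (fingraph.orbit h 1); split => //.
  by rewrite /ucycle cycle_orbit // orbit_uniq.
rewrite -(card_uniqP (orbit_uniq h 1)) (eq_card orbitE) -(cardC1 (0 : F)).
by apply: eq_card => x; rewrite !inE.
Qed.

(** If f is additive, then x + y determines f(x + y) = a x + b y for x, y in the two cosets, hence
    also (a - b) x, and so x and y. *)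
Lemma coset_map_not_additive (F : finFieldType) (n d m : nat) (w a b : F)
    (f : F -> F) :
    n.-primitive_root w -> n = #|F|.-1 -> (d * m)%N = n -> (d < m)%N ->
    (1 < d)%N -> a != b ->
    (forall x, x ^+ m = 1 -> f x = a * x) ->
    (forall x, x ^+ m = w ^+ m -> f x = b * x) ->
  ~ additive_function f.
Proof.
move=> prim_w def_n dm lt_dm d_gt1 ne_ab fa fb f_add.
have n_gt0 := prim_order_gt0 prim_w.
have F_gt1 := card_finNzRing_gt1 F.
pose S := roots_unity F m; pose S' := [set x : F | x ^+ m == w ^+ m].
have cardS : #|S| = m.
  by apply: card_roots_unity (dvdn_prim_root prim_w _); rewrite -dm dvdn_mull.
have cardS' : #|S'| = m.
  by have := @card_nth_roots F n d m 1 w prim_w; rewrite muln1; apply.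
have : (m * m <= #|F|)%N.
  rewrite -{1}cardS -cardS' -cardsX.
  rewrite -(card_in_imset (f := fun p : F * F => p.1 + p.2)) ?max_card //.
  move=> [x y] [x' y']; rewrite !inE /=.
  move=> /andP [/eqP xm /eqP ym] /andP [/eqP x'm /eqP y'm] e.
  have : f (x + y) = f (x' + y') by rewrite e.
  rewrite !f_add !(fa x, fa x', fb y, fb y') // => e'.
  have ex : x = x'.
    apply: (mulfI (x := a - b)); first by rewrite subr_eq0.
    transitivity (a * x + b * y - b * (x + y)); first by ring.
    by rewrite e' e; ring.
  by move: e; rewrite ex => /addrI ->.
(* The field has d m + 1 elements, whereas m >= d + 1 gives m^2 >= d m + m > d m + 1. *)
nia.
Qed.

(** * Construction of the complete mapping *)

Theorem theorem1p1p3 (d : nat) (hd : (1 < d)%N) :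
  exists C : nat, (0 < C)%N /\
    forall q : nat, prime_power q -> (q = 1 %[mod d])%N -> (C <= q)%N ->
    forall F : finFieldType, #|F| = q ->
    exists f : F -> F,
      [/\ complete_mapping f,
          f 0 = 0,
          permutes_nonzero_cyclically f,
          permutes_nonzero_cyclically (add_id f) &
          ~ additive_function f].
Proof.
have [C triple] := exists_primitive_triple hd.
(* This makes m = (q - 1)/d exceed C + d: m > C yields the triple, m > d rules out additivity. *)
exists (d * (C + d).+1).+1; split=> // q _ q_mod q_ge F cardF.
have q_gt0 : (0 < q)%N by apply: leq_trans q_ge.
have d_dvd : (d %| q.-1)%N.
  by rewrite -subn1 -eqn_mod_dvd //; apply/eqP.
pose m := (q.-1 %/ d)%N.
have dm : (d * m)%N = q.-1 by rewrite mulnC divnK.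
have m_gt : (C + d < m)%N.
  by rewrite leq_divRL ?(ltnW hd) // mulnC -ltnS prednK.
have [w prim_w] : exists w : F, q.-1.-primitive_root w.
  have q1_gt0 : (0 < q.-1)%N.
    by have := card_finNzRing_gt1 F; rewrite cardF; case: (q) => [|[]].
  have /hasP [w _ prim_w] : has q.-1.-primitive_root (enum [pred x : F | x != 0]).
    apply: has_prim_root => //; last 2 first.
    - exact: enum_uniq.
    - rewrite -cardE -cardF -(cardC1 (0 : F)).
      by apply/subset_leq_card/subsetP => x; rewrite !inE.
    apply/allP => x; rewrite mem_enum inE => x0.
    by rewrite unity_rootE -cardF expf_card_pred.
  by exists w.
have def_n : q.-1 = #|F|.-1 by rewrite cardF.
have C_lt : (C < m)%N by apply: leq_ltn_trans m_gt; apply: leq_addr.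
have d_lt : (d < m)%N by apply: leq_ltn_trans m_gt; apply: leq_addl.
have [a [b [c [ne_ab [aA bA cA] prim1 prim2]]]] :=
  triple F q.-1 m w prim_w def_n dm C_lt.
set z := w ^+ m in aA bA cA.
have prim_z : d.-primitive_root z by apply: prim_root_expr prim_w dm.
have expz (i j : nat) : (i < d)%N -> (j < d)%N -> (z ^+ i == z ^+ j) = (i == j).
  by move=> lt_i lt_j; rewrite (eq_prim_root_expr prim_z) !modn_small.
(* For d = 2 the value c is taken at no power of z, in accordance with the exponent d - 2 = 0. At x
   = 0 the coefficient is irrelevant, being multiplied by 0. *)
pose k u := if u == 1 then a else if u == z then b else c.
have kA u : k u \in coset_pairs m z by rewrite /k; case: ifP => //; case: ifP.
(* Taken with g the identity for f, and with g(u) = u + 1 for f + id. *)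
have prodk (g : F -> F) : \prod_(i < d) g (k (z ^+ i))
    = g a * g b * g c ^+ d.-2.
  have k0 : k (z ^+ 0) = a by rewrite /k expr0 eqxx.
  have kE i : (0 < i < d)%N -> k (z ^+ i) = if (i == 1)%N then b else c.
    move=> /andP [i_gt0 i_lt]; have := expz i 0%N i_lt (ltnW hd).
    have := expz i 1%N i_lt hd; rewrite /k expr0 expr1 => -> ->.
    by rewrite gtn_eqF.
  rewrite -(big_mkord xpredT (fun i => g (k (z ^+ i)))).
  rewrite big_ltn ?(ltnW hd) // big_ltn // k0 kE // mulrA; congr (_ * _).
  rewrite (eq_big_nat _ _ (F2 := fun=> g c)) => [|i /andP [i_ge2 i_lt]].
    by rewrite prodr_const_nat subn2.
  by rewrite kE ?i_lt ?(ltnW i_ge2) // gtn_eqF.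
pose f x := k (x ^+ m) * x.
have cyc_f : permutes_nonzero_cyclically f.
  apply: (coset_map_cyclic prim_w def_n dm (k := k)) => //.
    by move=> i _; have := kA (z ^+ i); rewrite inE => /andP [/eqP].
  by rewrite (prodk id).
have cyc_f1 : permutes_nonzero_cyclically (add_id f).
  apply: (coset_map_cyclic prim_w def_n dm (k := fun u => k u + 1)).
  - by move=> x; rewrite /add_id mulrDl mul1r.
  - by move=> i _; have := kA (z ^+ i); rewrite inE => /andP [_ /eqP].
  by rewrite (prodk (fun u => u + 1)).
exists f; split => //.
- by case: cyc_f; case: cyc_f1.
- by rewrite /f mulr0.
apply: (coset_map_not_additive prim_w def_n dm d_lt hd ne_ab).
  by move=> x xm; rewrite /f xm /k eqxx.
move=> x xm; rewrite /f xm /k -/z eqxx.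
by have := expz 1%N 0%N hd (ltnW hd); rewrite expr1 expr0 => ->.
Qed.
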